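(* The operad $\mathrm{DK}$ of Drinfeld--Kohno skew-symmetric quadratic data is the smallest sub-operad of the operad $\mathrm{BKW}$ of Berger--Kontsevich--Willwacher skew-symmetric quadratic data.
   Context: Work over $\mathbb Q$. For a vector space $V$ (in degree $0$), $V^{\wedge2}\subset V^{\otimes2}$ is spanned by $x\wedge y=x\otimes y-y\otimes x$. The category $\mathbf{QD}^-$ of skew-symmetric quadratic data has objects $(V,R)$ with $R\subset V^{\wedge2}$ and morphisms the linear maps $f$ with $f^{\otimes2}(R)\subset S$; its symmetric monoidal product is $(V,R)\oplus(W,S)=(V\oplus W,R\oplus[V,W]_-\oplus S)$, with $[V,W]_-=\langle v\otimes w-w\otimes v\mid v\in V,w\in W\rangle$, and unit $(0,0)$. An operad in $(\mathbf{QD}^-,\oplus)$ is a (symmetric, unital, with partial compositions) operad in this symmetric monoidal category, with components in all arities $n\ge0$. For $n\geq2$ let $V(n)$ be the vector space with basis $t^n_{ij}=t^n_{ji}$ indexed by the $2$-element subsets $\{i,j\}\subset\{1,\dots,n\}$; $V(0)=V(1)=0$. The symmetric group $\mathbb S_n$ acts by permuting the labels. For $1\le p\le n$ let $\pi_p:\{1,\dots,n+m-1\}\to\{1,\dots,n\}$ be the monotone surjection onto $\{1,\dots,n\}$ (onto $\{1,\dots,n\}\setminus\{p\}$ if $m=0$) collapsing $\{p,\dots,p+m-1\}$ to $p$ and injective elsewhere. The map $\circ_p:V(n)\oplus V(m)\to V(n+m-1)$ is $t^n_{ij}\mapsto\sum t^{n+m-1}_{i'j'}$, the sum over all $\{i',j'\}$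 mapped bijectively onto $\{i,j\}$ by $\pi_p$, and $t^m_{ij}\mapsto t^{n+m-1}_{i+p-1\,j+p-1}$. $\mathrm{BKW}(n)=(V(n),V(n)^{\wedge2})$. $\mathrm{DK}(n)=(V(n),R(n))$, where $R(n)$ is spanned by the $t^n_{ij}\wedge t^n_{kl}$ for $\{i,j\}\cap\{k,l\}=\emptyset$, and the $t^n_{ij}\wedge(t^n_{ik}+t^n_{jk})$ for $i,j,k$ distinct. With the maps $\circ_p$, both are operads in $(\mathbf{QD}^-,\oplus)$. A sub-operad of $\mathrm{BKW}$ is a collection of skew-symmetric quadratic data $(V(n),S(n))$, $S(n)\subset V(n)^{\wedge2}$, $n\ge0$, with the same generators $V(n)$, that is stable under the partial composition products $\circ_p$ and the symmetric group actions, i.e. forms an operad in $(\mathbf{QD}^-,\oplus)$ with these structure maps. Sub-operads are ordered by inclusion of the relation spaces $S(n)$ for all $n$. *)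

(* Defs.v *)
From HB Require Import structures.
From mathcomp Require Import all_boot all_order all_algebra all_fingroup.

Set Implicit Arguments.
Unset Strict Implicit.
Unset Printing Implicit Defensive.

Import GRing.Theory.
Local Open Scope ring_scope.

(* The tensor square of a finite-dimensional space V is modelled by the      *)
(* matrices of coordinates in the basis e_i (x) e_j, where e is the standard *)
(* basis vbasis fullv of V; tens2E shows that tens2 f is f (x) f.            *)
Definition tens_sq (V : vectType rat) : vectType rat := 'M[rat]_(\dim {:V}).

Definition tens (V : vectType rat) (x y : V) : tens_sq V :=
  \matrix_(i, j) (coord (vbasis {:V}) i x * coord (vbasis {:V}) j y).

Definition wedge (V : vectType rat) (x y : V) : tens_sq V :=
  tens x y - tens y x.

Definition tens2_fun (V W : vectType rat) (f : 'Hom(V, W)) (M : tens_sq V) :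
    tens_sq W :=
  \sum_i \sum_j M i j *: tens (f (vbasis {:V})`_i) (f (vbasis {:V})`_j).

Definition tens2 (V W : vectType rat) (f : 'Hom(V, W)) :
  'Hom(tens_sq V, tens_sq W) := linfun (tens2_fun f).

Fact tens2_fun_linear (V W : vectType rat) (f : 'Hom(V, W)) :
  linear (tens2_fun f).
Proof.
move=> a M N; rewrite /tens2_fun scaler_sumr -big_split; apply: eq_bigr => i _.
rewrite scaler_sumr -big_split; apply: eq_bigr => j _ /=.
by rewrite !mxE scalerDl scalerA.
Qed.
HB.instance Definition _ (V W : vectType rat) (f : 'Hom(V, W)) :=
  GRing.isLinear.Build rat (tens_sq V) (tens_sq W) _ (tens2_fun f)
    (tens2_fun_linear f).

Lemma tens_suml (V : vectType rat) (I : finType) (c : I -> rat) (X : I -> V) y :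
  tens (\sum_i c i *: X i) y = \sum_i c i *: tens (X i) y.
Proof.
apply/matrixP => i j; rewrite summxE mxE linear_sum /= mulr_suml.
by apply: eq_bigr => l _; rewrite linearZ /= !mxE mulrA.
Qed.

Lemma tens_sumr (V : vectType rat) (I : finType) (c : I -> rat) (X : I -> V) y :
  tens y (\sum_i c i *: X i) = \sum_i c i *: tens y (X i).
Proof.
apply/matrixP => i j; rewrite summxE mxE linear_sum /= mulr_sumr.
by apply: eq_bigr => l _; rewrite linearZ /= !mxE mulrCA.
Qed.

Lemma tens2E (V W : vectType rat) (f : 'Hom(V, W)) x y :
  tens2 f (tens x y) = tens (f x) (f y).
Proof.
rewrite lfunE /= /tens2_fun.
rewrite [in RHS](coord_vbasis (memvf x)) [in RHS](coord_vbasis (memvf y)).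
rewrite !linear_sum /=.
under [in RHS]eq_bigr do rewrite linearZ /=.
rewrite tens_suml; apply: eq_bigr => i _.
under [in RHS]eq_bigr do rewrite linearZ /=.
rewrite tens_sumr scaler_sumr; apply: eq_bigr => j _.
by rewrite !mxE scalerA.
Qed.

Lemma tens2_wedge (V W : vectType rat) (f : 'Hom(V, W)) x y :
  tens2 f (wedge x y) = wedge (f x) (f y).
Proof. by rewrite /wedge linearB /= !tens2E. Qed.

(* This is the span of all the wedge x y, by memv_wedge.                     *)
Definition wedge2 (V : vectType rat) : {vspace tens_sq V} :=
  <<[seq wedge x y | x <- vbasis {:V}, y <- vbasis {:V}]>>%VS.

Lemma memv_wedge (V : vectType rat) (x y : V) : wedge x y \in wedge2 V.
Proof.
rewrite (coord_vbasis (memvf x)) (coord_vbasis (memvf y)) /wedge.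
rewrite tens_suml [X in _ - X]tens_sumr -sumrB; apply: memv_suml => i _.
rewrite -scalerBr memvZ // tens_sumr tens_suml -sumrB.
apply: memv_suml => j _; rewrite -scalerBr memvZ //; apply: memv_span.
by apply: allpairs_f; rewrite mem_nth // size_tuple.
Qed.

Lemma limg_wedge2 (V W : vectType rat) (f : 'Hom(V, W)) :
  (tens2 f @: wedge2 V <= wedge2 W)%VS.
Proof.
rewrite limg_span; apply/span_subvP => _ /mapP[_ /allpairsP[u [_ _ ->]] ->].
by rewrite tens2_wedge memv_wedge.
Qed.

(* Skew-symmetric quadratic data, the objects of the category QD^-. *)
Record qd := QD {
  generators : vectType rat;
  relations : {vspace tens_sq generators};
  relations_wedge2 : (relations <= wedge2 generators)%VS
}.

Definition is_qd_mor (P Q : qd) (f : 'Hom(generators P, generators Q)) : Prop :=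
  (tens2 f @: relations P <= relations Q)%VS.

Section Sum.
Variables V W : vectType rat.

Definition inj1_fun (v : V) : (V * W)%type := (v, 0).
Definition inj2_fun (w : W) : (V * W)%type := (0, w).

Fact inj1_fun_linear : linear inj1_fun.
Proof. by move=> a u v; congr (_, _); rewrite /= scaler0 addr0. Qed.
Fact inj2_fun_linear : linear inj2_fun.
Proof. by move=> a u v; congr (_, _); rewrite /= scaler0 addr0. Qed.
HB.instance Definition _ :=
  GRing.isLinear.Build rat V (V * W)%type _ inj1_fun inj1_fun_linear.
HB.instance Definition _ :=
  GRing.isLinear.Build rat W (V * W)%type _ inj2_fun inj2_fun_linear.

Definition inj1 : 'Hom(V, (V * W)%type) := linfun inj1_fun.
Definition inj2 : 'Hom(W, (V * W)%type) := linfun inj2_fun.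

Definition mixed : {vspace tens_sq (V * W)%type} :=
  <<[seq wedge (inj1 v) (inj2 w) | v <- vbasis {:V}, w <- vbasis {:W}]>>%VS.
End Sum.

Definition qd_sum_rel (P Q : qd) :
    {vspace tens_sq (generators P * generators Q)%type} :=
  (tens2 (inj1 (generators P) (generators Q)) @: relations P
   + mixed (generators P) (generators Q)
   + tens2 (inj2 (generators P) (generators Q)) @: relations Q)%VS.

Fact qd_sum_rel_wedge2 P Q :
  (qd_sum_rel P Q <= wedge2 (generators P * generators Q)%type)%VS.
Proof.
rewrite /qd_sum_rel !subv_add -andbA; apply/and3P; split.
- exact: subv_trans (limgS _ (relations_wedge2 P)) (limg_wedge2 _).
- apply/span_subvP => _ /allpairsP[u [_ _ ->]]; exact: memv_wedge.
- exact: subv_trans (limgS _ (relations_wedge2 Q)) (limg_wedge2 _).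
Qed.

Definition qd_sum (P Q : qd) : qd := QD (@qd_sum_rel_wedge2 P Q).

(* Inputs are numbered from 0: 'I_n is {0, ..., n-1}.  The arity             *)
(* k = n + m - 1 of a partial composite is given by an equation              *)
(* n + m = k + 1, so that no transport along arity equalities is needed.     *)
(* collapse e p is the monotone map pi_p that sends the block                *)
(* {p, ..., p+m-1} to p; its image is 'I_n, without p when m = 0.            *)
Definition collapse_val (p m i : nat) : nat :=
  if (i < p)%N then i else if (i < p + m)%N then p else (i - m).+1.

Fact collapse_subproof n m k (e : (n + m = k.+1)%N) (p : 'I_n) (i : 'I_k) :
  (collapse_val p m i < n)%N.
Proof.
rewrite /collapse_val; case: (ltnP i p) => [ip | _].
  exact: ltn_trans ip (ltn_ord p).
case: (ltnP i (p + m)) => // h; rewrite -(ltn_add2r m) e addSn subnK ?ltnS //.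
exact: leq_trans (leq_addl _ _) h.
Qed.

Definition collapse n m k (e : (n + m = k.+1)%N) (p : 'I_n) (i : 'I_k) : 'I_n :=
  Ordinal (collapse_subproof e p i).

Fact embed_subproof n m k (e : (n + m = k.+1)%N) (p : 'I_n) (j : 'I_m) :
  (p + j < k)%N.
Proof. by rewrite -ltnS -e -addnS -addSn leq_add. Qed.

Definition embed n m k (e : (n + m = k.+1)%N) (p : 'I_n) (j : 'I_m) : 'I_k :=
  Ordinal (embed_subproof e p j).

(* r is the block permutation s o_p t of the k inputs of a composite x o_p y *)
(* induced by relabelling the inputs of x along s and those of y along t;    *)
(* it is determined by the two equations.                                    *)
Definition is_block_perm n m k (e : (n + m = k.+1)%N) (p : 'I_n)
    (s : 'S_n) (t : 'S_m) (r : 'S_k) : Prop :=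
  (forall i, collapse e (s p) (r i) = s (collapse e p i)) /\
  (forall j, r (embed e p j) = embed e (s p) (t j)).

Record operad_data := OperadData {
  obj : nat -> qd;
  perm_act : forall n, 'S_n -> 'End(generators (obj n));
  pcomp : forall n m k, (n + m = k.+1)%N -> 'I_n ->
    'Hom((generators (obj n) * generators (obj m))%type, generators (obj k))
}.
Arguments perm_act P {n} s : rename.
Arguments pcomp P {n m k} e p : rename.

(* Operads in the symmetric monoidal category (QD^-, (+)).  The action is by *)
(* relabelling of the inputs: a left action for the composition of           *)
(* functions, whereas (s * t) i = t (s i) in 'S_n.  The monoidal unit (0, 0) *)
(* is an initial object, so that the operadic unit (0, 0) -> P(1) carries no *)
(* information and picks out 0 in P(1).                                      *)
Record is_operad (P : operad_data) : Prop := IsOperad {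
  act_mor : forall n (s : 'S_n), @is_qd_mor (obj P n) (obj P n) (perm_act P s);
  comp_mor : forall n m k (e : (n + m = k.+1)%N) (p : 'I_n),
    @is_qd_mor (qd_sum (obj P n) (obj P m)) (obj P k) (pcomp P e p);
  act_id : forall n (x : generators (obj P n)), perm_act P 1%g x = x;
  act_mul : forall n (s t : 'S_n) (x : generators (obj P n)),
    perm_act P (s * t)%g x = perm_act P t (perm_act P s x);
  comp_equivariant : forall n m k (e : (n + m = k.+1)%N) (p : 'I_n)
      (s : 'S_n) (t : 'S_m) (r : 'S_k)
      (x : generators (obj P n)) (y : generators (obj P m)),
    is_block_perm e p s t r ->
    perm_act P r (pcomp P e p (x, y))
    = pcomp P e (s p) (perm_act P s x, perm_act P t y);
  comp_unitl : forall m (e : (1 + m = m.+1)%N) (p : 'I_1)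
      (y : generators (obj P m)),
    pcomp P e p (0, y) = y;
  comp_unitr : forall n (e : (n + 1 = n.+1)%N) (p : 'I_n)
      (x : generators (obj P n)),
    pcomp P e p (x, 0) = x;
  (* (x o_p y) o_(p+q) z = x o_p (y o_q z) *)
  comp_sequential : forall n m l k k' h
      (e1 : (n + m = k.+1)%N) (e2 : (k + l = h.+1)%N)
      (e1' : (m + l = k'.+1)%N) (e2' : (n + k' = h.+1)%N)
      (p : 'I_n) (q : 'I_m)
      (x : generators (obj P n)) (y : generators (obj P m))
      (z : generators (obj P l)),
    pcomp P e2 (embed e1 p q) (pcomp P e1 p (x, y), z)
    = pcomp P e2' p (x, pcomp P e1' q (y, z));
  (* (x o_p y) o_(q+m-1) z = (x o_q z) o_p y for p < q *)
  comp_parallel : forall n m l k k' h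
      (e1 : (n + m = k.+1)%N) (e2 : (k + l = h.+1)%N)
      (e1' : (n + l = k'.+1)%N) (e2' : (k' + m = h.+1)%N)
      (p q : 'I_n) (p' : 'I_k') (q' : 'I_k)
      (x : generators (obj P n)) (y : generators (obj P m))
      (z : generators (obj P l)),
    (p < q)%N -> p' = p :> nat -> (q'.+1 = q + m)%N ->
    pcomp P e2 q' (pcomp P e1 p (x, y), z)
    = pcomp P e2' p' (pcomp P e1' q (x, z), y)
}.

Definition with_relations (P : operad_data)
    (S : forall n, {vspace tens_sq (generators (obj P n))})
    (hS : forall n, (S n <= wedge2 (generators (obj P n)))%VS) : operad_data :=
  @OperadData (fun n => QD (hS n)) (@perm_act P) (@pcomp P).

Definition is_suboperad (P : operad_data)
    (S : forall n, {vspace tens_sq (generators (obj P n))}) : Prop :=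
  (forall n, (S n <= relations (obj P n))%VS) /\
  exists hS : forall n, (S n <= wedge2 (generators (obj P n)))%VS,
    is_operad (with_relations hS).
Arguments is_suboperad P S : clear implicits.

Definition edge (n : nat) := {A : {set 'I_n} | #|A| == 2%N}.

(* The space V(n); the basis is indexed by edge n, hence V(0) = V(1) = 0. *)
Definition Vgen (n : nat) : vectType rat := {ffun edge n -> rat^o}.

(* The basis vector t_A, for #|A| = 2; this is 0 if #|A| <> 2. *)
Definition tset n (A : {set 'I_n}) : Vgen n :=
  [ffun B : edge n => (val B == A)%:R : rat^o].

Definition tgen n (i j : 'I_n) : Vgen n := tset [set i; j].

Definition lin_ext_fun n (W : vectType rat) (g : edge n -> W)
    (x : Vgen n) : W :=
  \sum_A x A *: g A.

Fact lin_ext_fun_linear n (W : vectType rat) (g : edge n -> W) :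
  linear (lin_ext_fun g).
Proof.
move=> a x y; rewrite /lin_ext_fun scaler_sumr -big_split.
apply: eq_bigr => A _.
by rewrite !ffunE /= scalerDl scalerA.
Qed.
HB.instance Definition _ n (W : vectType rat) (g : edge n -> W) :=
  GRing.isLinear.Build rat (Vgen n) W _ (lin_ext_fun g) (lin_ext_fun_linear g).

Definition relabel n (s : 'S_n) : 'End(Vgen n) :=
  linfun (lin_ext_fun (fun A : edge n => tset (s @: val A))).

Section Composition.
Variables (n m k : nat) (e : (n + m = k.+1)%N) (p : 'I_n).

Definition insertion_fun (u : (Vgen n * Vgen m)%type) : Vgen k :=
  lin_ext_fun (fun A : edge n =>
    \sum_(B : edge k | collapse e p @: val B == val A) tset (val B)) u.1
  + lin_ext_fun (fun A : edge m => tset (embed e p @: val A)) u.2.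

Fact insertion_fun_linear : linear insertion_fun.
Proof.
by move=> a u v; rewrite /insertion_fun !linearP /= scalerDr addrACA.
Qed.
HB.instance Definition _ :=
  GRing.isLinear.Build rat (Vgen n * Vgen m)%type (Vgen k) _ insertion_fun
    insertion_fun_linear.

Definition insertion : 'Hom((Vgen n * Vgen m)%type, Vgen k) :=
  linfun insertion_fun.
End Composition.

Definition DK_rel (n : nat) : {vspace tens_sq (Vgen n)} :=
  (\sum_(i < n) \sum_(j < n) \sum_(k < n) \sum_(l < n | uniq [:: i; j; k; l])
     <[wedge (tgen i j) (tgen k l)]>
   + \sum_(i < n) \sum_(j < n) \sum_(k < n | uniq [:: i; j; k])
     <[wedge (tgen i j) (tgen i k + tgen j k)]>)%VS.

Fact DK_rel_wedge2 n : (DK_rel n <= wedge2 (Vgen n))%VS.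
Proof.
rewrite /DK_rel subv_add; apply/andP; split; repeat (apply/subv_sumP => ? _);
  by rewrite -memvE memv_wedge.
Qed.

Definition DK : operad_data :=
  @OperadData (fun n => QD (@DK_rel_wedge2 n)) relabel insertion.

Definition BKW : operad_data :=
  @OperadData (fun n => QD (subvv (wedge2 (Vgen n)))) relabel insertion.

(* Main.v *)
Require Import Defs.
From HB Require Import structures.
From mathcomp Require Import all_boot all_algebra all_fingroup zify.

(** The whole argument rests on the mixed relations of the monoidal product:
    a partial composition is a morphism on (V, R) (+) (W, S) only if the image
    of V commutes with the image of W, that is, if
      (x o_p 0) /\ (0 o_p y)
    is a relation for all x and y.

    This already forces every Drinfeld-Kohno relation.  Number labels from 0,
    and take y to be the generator t_01 of arity 2, inserted at input 0.  For
    x = t_01 the insertion doubles the label 0, and x o_0 0 = t_02 + t_12 must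
    commute with t_01; for x = t_12 it shifts both labels, and x o_0 0 = t_23
    must commute with t_01.  The symmetric group carries these two relations to
    all the triangle relations and to all the relations between disjoint pairs
    (suboperad_triangle, suboperad_disjoint).

    Conversely the Drinfeld-Kohno relations are stable.  The insertion
    replaces every label by its fibre under the collapse map pi: t_ij becomes
    the sum of the t_ab for a over i and b over j.  Everything follows from a relation in
    which a whole set of labels replaces the two ends of an edge (DK_star): if
    a and b lie in X and d does not, then t_ab commutes with the sum over x in
    X of the t_xd.  The terms x = a and x = b form a triangle relation, and
    the edges of the other terms are disjoint from {a, b}.  For X a fibre of pi
    this gives the mixed relations (insertion_mixed); for X the union of two
    fibres it gives the image of a triangle relation (insertion_DKl).

    The remaining operad axioms do not involve the relations: they are
    identities between linear maps on the V(n).  They are checked on the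
    coordinates coef i j x of x, extended by zero to all natural numbers i, j,
    for which insertion has a closed formula (coef_insertion).  The unit and
    associativity axioms then become identities between piecewise affine
    functions of i and j, and equivariance compares the two sides at r i, r j
    for the block permutation r. *)

Set Implicit Arguments.
Unset Strict Implicit.
Unset Printing Implicit Defensive.

Import GRing.Theory.
Local Open Scope ring_scope.

(** * Coordinates on V(n) *)

(** Indexing by natural numbers rather than by 'I_n makes out of range and equal
    indices harmless: the set then has fewer than two elements. *)
Definition pairset n (i j : nat) : {set 'I_n} :=
  [set l : 'I_n | (l == i :> nat) || (l == j :> nat)].

Lemma pairsetE n (i j : 'I_n) : pairset n i j = [set i; j].
Proof. by apply/setP=> l; rewrite !inE. Qed.

Lemma pairsetC n i j : pairset n i j = pairset n j i.
Proof. by apply/setP=> l; rewrite !inE orbC. Qed.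

Lemma card_pairset n i j :
  (#|pairset n i j| == 2) = [&& i != j, i < n & j < n]%N.
Proof.
have small a b : ~~ (b < n)%N || (a == b) -> (#|pairset n a b| <= 1)%N.
  move=> h; apply/card_le1P => l; rewrite inE => lab l'; rewrite !inE -val_eqE /=.
  by have := ltn_ord l; have := ltn_ord l'; lia.
case: (boolP [&& i != j, i < n & j < n]%N) => [/and3P[ij li lj]|].
  rewrite -[i]/(val (Ordinal li)) -[j]/(val (Ordinal lj)) pairsetE cards2.
  by rewrite -val_eqE /= ij.
rewrite !negb_and negbK => h; apply: negbTE; rewrite neq_ltn ltnS.
case/or3P: h => h; first by rewrite small // h orbT.
  by rewrite pairsetC small // h.
by rewrite small // h.
Qed.

(** No edge equals a set that does not have two elements, so this is the
    coefficient of x at t_ij extended by 0 to i = j and to indices >= n.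
    The values are in rat^o for the sake of linearity. *)
Definition coef n (i j : nat) (x : Vgen n) : rat^o :=
  \sum_(A : edge n | val A == pairset n i j) x A.

Fact coef_is_linear n i j : linear (@coef n i j).
Proof.
move=> a x y; rewrite /coef scaler_sumr -big_split; apply: eq_bigr => A _.
by rewrite !ffunE.
Qed.
HB.instance Definition _ n i j :=
  GRing.isLinear.Build rat (Vgen n) rat^o _ (@coef n i j) (@coef_is_linear n i j).

Lemma coef_eq0 n i j (x : Vgen n) :
  ~~ [&& i != j, i < n & j < n]%N -> coef i j x = 0.
Proof.
rewrite -card_pairset => h; rewrite /coef big1 // => A /eqP E.
by rewrite -E (valP A) in h.
Qed.

Lemma edgeP n (A : edge n) : exists i j : 'I_n, i != j /\ val A = [set i; j].
Proof. by have /cards2P[i [j [ij ->]]] := valP A; exists i, j. Qed.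

Lemma coef_ext n (x y : Vgen n) :
  (forall i j : 'I_n, i != j -> coef i j x = coef i j y) -> x = y.
Proof.
move=> h; apply/ffunP=> A; have [i [j [ij E]]] := edgeP A.
have := h _ _ ij; rewrite /coef !(big_pred1 A) // => B.
  by rewrite pairsetE -E val_eqE.
by rewrite pairsetE -E val_eqE.
Qed.

Lemma coef_tset n i j (A : {set 'I_n}) :
  coef i j (tset A) = ([&& i != j, i < n & j < n]%N && (A == pairset n i j))%:R.
Proof.
rewrite -card_pairset /coef; case: (boolP (#|_| == 2%N)) => [c2|/negbTE c2] /=.
  rewrite (big_pred1 (Sub (pairset n i j) c2 : edge n)).
    by rewrite ffunE eq_sym.
  by move=> B; rewrite -val_eqE.
by rewrite big_pred0 // => B; apply: contraFF c2 => /eqP<-; exact: (valP B).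
Qed.

Lemma coef_tgen n (i j : nat) (a b : 'I_n) : a != b -> i != j -> 
  coef i j (tgen a b) = ((a == i :> nat) && (b == j :> nat))%:R
                      + ((a == j :> nat) && (b == i :> nat))%:R.
Proof.
move=> ab ij; rewrite coef_tset ij /=.
have -> : (i < n)%N && (j < n)%N && ([set a; b] == pairset n i j)
  = ((a == i :> nat) && (b == j :> nat)) || ((a == j :> nat) && (b == i :> nat)).
  apply/idP/idP.
    case/andP=> _ /eqP/setP E; have := E a; have := E b.
    rewrite !inE !eqxx orbT /=.
    by move: ab; rewrite -val_eqE /=; lia.
  move=> h; have -> : ((i < n) && (j < n))%N.
    by have := ltn_ord a; have := ltn_ord b; lia.
  by apply/eqP/setP => l; rewrite !inE -!val_eqE /=; lia.
move: ab; rewrite -val_eqE /= => ab.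
by case: eqP => ?; case: eqP => ?; case: eqP => ?; case: eqP => ? //=; lia.
Qed.

Lemma Vgen_decomp n (x : Vgen n) : x = \sum_(A : edge n) x A *: tset (val A).
Proof.
apply/ffunP => A; rewrite sum_ffunE (bigD1 A) //= !ffunE eqxx big1 ?addr0.
  by rewrite /GRing.scale /= mulr1.
move=> B; rewrite !ffunE eq_sym => h.
by rewrite val_eqE (negbTE h) scaler0.
Qed.

Lemma coef_lin_ext n m (g : edge m -> Vgen n) (x : Vgen m) i j :
  coef i j (lin_ext_fun g x) = \sum_A x A * coef i j (g A).
Proof. by rewrite linear_sum; apply: eq_bigr => A _; rewrite linearZ. Qed.

Lemma sum_mul_pred n (x : Vgen n) (P : pred (edge n)) :
  \sum_A x A * (P A)%:R = \sum_(A | P A) x A :> rat.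
Proof.
rewrite [RHS]big_mkcond; apply: eq_bigr => A _.
by case: (P A); rewrite ?mulr1 ?mulr0.
Qed.

Lemma coef_relabel n (s : 'S_n) (x : Vgen n) (i j : 'I_n) :
  coef (s i) (s j) (relabel s x) = coef i j x.
Proof.
case: (eqVneq i j) => [<-|ij]; first by rewrite !coef_eq0 // eqxx.
rewrite lfunE /= coef_lin_ext.
transitivity (\sum_A x A * (val A == pairset n i j)%:R : rat^o);
  last exact: sum_mul_pred.
apply: eq_bigr => A _; congr (_ * _).
rewrite coef_tset !ltn_ord val_eqE (inj_eq perm_inj) ij !pairsetE /=.
by rewrite -(inj_eq (imset_inj (@perm_inj _ s)) (val A)) imsetU1 imset_set1.
Qed.

(** * The closed formula for insertion *)

Section Insertion.
Variables (n m k : nat) (e : (n + m = k.+1)%N) (p : 'I_n).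

Lemma embed_inj : injective (@embed n m k e p).
Proof. by move=> a b /(congr1 val) /addnI /val_inj. Qed.

Lemma insertion_pair (x : Vgen n) (y : Vgen m) :
  insertion e p (x, y) = insertion e p (x, 0) + insertion e p (0, y).
Proof.
by rewrite -linearD; congr (insertion e p (_, _)); rewrite /= ?addr0 ?add0r.
Qed.

Lemma coef_insertionl (x : Vgen n) (i j : 'I_k) :
  coef i j (insertion e p (x, 0)) = coef (collapse e p i) (collapse e p j) x.
Proof.
case: (eqVneq i j) => [<-|ij]; first by rewrite !coef_eq0 // eqxx.
rewrite lfunE /= /insertion_fun /= linear0 addr0 coef_lin_ext.
transitivity (\sum_A x A *
    (val A == pairset n (collapse e p i) (collapse e p j))%:R : rat^o);
  last exact: sum_mul_pred.
apply: eq_bigr => A _; congr (_ * _); rewrite linear_sum /=.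
have c2 : #|[set i; j]| == 2%N by rewrite cards2 ij.
rewrite (eq_bigr (fun B : edge k => (val B == [set i; j])%:R)); last first.
  by move=> B _; rewrite coef_tset val_eqE ij !ltn_ord pairsetE.
rewrite (eq_bigr (fun B : edge k => if B == Sub [set i; j] c2 then 1 else 0));
  last first.
  by move=> B _; rewrite -(val_eqE B) SubK; case: (_ == _).
rewrite -big_mkcondr big_mkcond (bigD1 (Sub [set i; j] c2)) //= eqxx andbT.
rewrite imsetU1 imset_set1 (pairsetE (collapse e p i) (collapse e p j)) eq_sym.
rewrite big1 ?addr0; first by case: (_ == _).
by move=> B /negbTE->; rewrite andbF.
Qed.

Lemma coef_insertionr (y : Vgen m) (i j : 'I_k) :
  coef i j (insertion e p (0, y))
  = if (p <= i)%N && (p <= j)%N then coef (i - p) (j - p) y else 0.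
Proof.
case: (eqVneq i j) => [<-|ij].
  by rewrite !coef_eq0 ?eqxx //=; case: ifP.
rewrite lfunE /= /insertion_fun /= linear0 add0r coef_lin_ext.
case: (boolP [&& p <= i, p <= j, i - p < m & j - p < m]%N) => [|out].
  case/and4P=> pi pj im jm; rewrite pi pj.
  transitivity (\sum_A y A * (val A == pairset m (i - p) (j - p))%:R : rat^o);
    last exact: sum_mul_pred.
  apply: eq_bigr => A _; congr (_ * _).
  rewrite coef_tset !ltn_ord val_eqE ij /=.
  rewrite -[(i - p)%N]/(val (Ordinal im)) -[(j - p)%N]/(val (Ordinal jm)).
  rewrite !pairsetE.
  rewrite -(inj_eq (imset_inj embed_inj) (val A)) imsetU1 imset_set1.
  have emb (l : 'I_k) (lm : (l - p < m)%N) : (p <= l)%N -> embed e p (Ordinal lm) = l.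
    by move=> pl; apply: val_inj; rewrite /= subnKC.
  by rewrite !emb.
transitivity (0 : rat); last first.
  by case: ifP => // ?; rewrite coef_eq0 //; lia.
apply: big1 => A _; rewrite coef_tset !ltn_ord val_eqE ij pairsetE /=.
rewrite (_ : (_ == _) = false) ?mulr0 //; apply/negP => /eqP E.
have /imsetP[a _ ia] : i \in [set embed e p x | x in val A].
  by rewrite E !inE eqxx.
have /imsetP[b _ jb] : j \in [set embed e p x | x in val A].
  by rewrite E !inE eqxx orbT.
by move: out; rewrite ia jb /=; have := ltn_ord a; have := ltn_ord b; lia.
Qed.

(** Both coefficients on the right vanish by themselves when i or j is >= k, so
    that the formula has no side condition and can be iterated. *)
Lemma coef_insertion (x : Vgen n) (y : Vgen m) (i j : nat) :
  coef i j (insertion e p (x, y))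
  = coef (collapse_val p m i) (collapse_val p m j) x
    + if (p <= i)%N && (p <= j)%N then coef (i - p) (j - p) y else 0.
Proof.
case: (boolP ((i < k) && (j < k))%N) => [/andP[ik jk]|out].
  rewrite insertion_pair linearD /=.
  rewrite (coef_insertionl x (Ordinal ik) (Ordinal jk)).
  by rewrite (coef_insertionr y (Ordinal ik) (Ordinal jk)).
rewrite coef_eq0; last by lia.
rewrite [X in X + _]coef_eq0; last first.
  by rewrite /collapse_val; do 4?case: ifP; have := ltn_ord p; lia.
by rewrite add0r; case: ifP => // h; rewrite coef_eq0 //; have := ltn_ord p; lia.
Qed.
End Insertion.

(** * Operad axioms for the insertion maps *)

Lemma relabel1 n (x : Vgen n) : relabel 1%g x = x.
Proof.
apply: coef_ext => i j _.
by rewrite -[i in LHS](perm1 i) -[j in LHS](perm1 j) coef_relabel.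
Qed.

Lemma relabelM n (s t : 'S_n) (x : Vgen n) :
  relabel (s * t)%g x = relabel t (relabel s x).
Proof.
apply: coef_ext => i j _.
rewrite -[i](permKV (s * t)%g) -[j](permKV (s * t)%g) coef_relabel.
by rewrite !permM !coef_relabel.
Qed.

Lemma collapse1 p i : collapse_val p 1 i = i.
Proof. by rewrite /collapse_val; do 2?case: ifP; lia. Qed.

Lemma insertion_unitl m (e : (1 + m = m.+1)%N) (p : 'I_1) (y : Vgen m) :
  insertion e p (0, y) = y.
Proof.
apply: coef_ext => i j _.
by rewrite coef_insertion linear0 add0r ord1 !subn0.
Qed.

Lemma insertion_unitr n (e : (n + 1 = n.+1)%N) (p : 'I_n) (x : Vgen n) :
  insertion e p (x, 0) = x.
Proof.
by apply: coef_ext => i j _; rewrite coef_insertion linear0 if_same addr0 !collapse1.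
Qed.

(** A block permutation maps the block at p onto the block at s p, since r is
    injective and the blocks have the same size. *)
Lemma block_perm_cases n m k (e : (n + m = k.+1)%N) (p : 'I_n)
    (s : 'S_n) (t : 'S_m) (r : 'S_k) (i : 'I_k) :
  is_block_perm e p s t r ->
  (exists2 a : 'I_m, i = embed e p a & r i = embed e (s p) (t a))
  \/ (~~ (p <= i < p + m)%N /\ ~~ (s p <= r i < s p + m)%N).
Proof.
case=> _ remb.
have split_block (q : 'I_n) (l : 'I_k) :
    (exists a, l = embed e q a) \/ ~~ (q <= l < q + m)%N.
  case: (boolP (q <= l < q + m)%N) => [ql|_]; [left | by right].
  have am : (l - q < m)%N by lia.
  by exists (Ordinal am); apply: val_inj => /=; lia.
case: (split_block p i) => [[a ->]|iout]; first by left; exists a.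
case: (split_block (s p) (r i)) => [[b rib]|]; last by right.
case/negP: iout; have -> : i = embed e p ((t^-1)%g b).
  by apply: (@perm_inj _ r); rewrite remb permKV.
by rewrite /= leq_addr ltn_add2l ltn_ord.
Qed.

Lemma insertion_equivariant n m k (e : (n + m = k.+1)%N) (p : 'I_n)
    (s : 'S_n) (t : 'S_m) (r : 'S_k) (x : Vgen n) (y : Vgen m) :
  is_block_perm e p s t r ->
  relabel r (insertion e p (x, y))
  = insertion e (s p) (relabel s x, relabel t y).
Proof.
move=> rst; apply: coef_ext => i j _.
rewrite -[i](permKV r) -[j](permKV r); move: (r^-1 _)%g (r^-1 _)%g => {}j {}i.
rewrite coef_relabel !coef_insertion; congr (_ + _).
  have cs l : collapse_val (s p) m (r l) = s (collapse e p l).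
    by rewrite -rst.1.
  by rewrite !cs coef_relabel.
have out (q : nat) (l l' : nat) (z : Vgen m) :
    ~~ (q <= l < q + m)%N || ~~ (q <= l' < q + m)%N ->
    (if (q <= l)%N && (q <= l')%N then coef (l - q) (l' - q) z else 0) = 0.
  by move=> ?; case: ifP => // ?; rewrite coef_eq0 //; lia.
case: (block_perm_cases i rst) => [[a -> ->]|[iout riout]]; last first.
  by rewrite !out ?iout ?riout.
case: (block_perm_cases j rst) => [[b -> ->]|[jout rjout]]; last first.
  by rewrite !out ?jout ?rjout ?orbT.
by rewrite /= !leq_addr !addKn coef_relabel.
Qed.

Lemma insertion_sequential n m l k k' h
    (e1 : (n + m = k.+1)%N) (e2 : (k + l = h.+1)%N)
    (e1' : (m + l = k'.+1)%N) (e2' : (n + k' = h.+1)%N)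
    (p : 'I_n) (q : 'I_m) (x : Vgen n) (y : Vgen m) (z : Vgen l) :
  insertion e2 (embed e1 p q) (insertion e1 p (x, y), z)
  = insertion e2' p (x, insertion e1' q (y, z)).
Proof.
apply: coef_ext => i j _; rewrite !coef_insertion /=.
have qm := ltn_ord q.
(* The collapse maps compose like the insertions, and the coefficients of x,
   y and z are compared one by one. *)
have cc u : collapse_val p m (collapse_val (p + q) l u) = collapse_val p k' u.
  by rewrite /collapse_val; repeat case: ifP; lia.
rewrite !cc -addrA; congr (_ + _).
have pc u : (p <= collapse_val (p + q) l u)%N = (p <= u)%N.
  by rewrite /collapse_val; repeat case: ifP; lia.
rewrite !pc; case: (boolP ((p <= i) && (p <= j))%N) => [/andP[pi pj]|pij].
  have cs u : (p <= u)%N -> (collapse_val (p + q) l u - p)%N = collapse_val q l (u - p).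
    by rewrite /collapse_val; repeat case: ifP; lia.
  by rewrite !cs // !leq_subRL // !subnDA.
by rewrite add0r; case: ifP => //; lia.
Qed.

Lemma insertion_parallel n m l k k' h
    (e1 : (n + m = k.+1)%N) (e2 : (k + l = h.+1)%N)
    (e1' : (n + l = k'.+1)%N) (e2' : (k' + m = h.+1)%N)
    (p q : 'I_n) (p' : 'I_k') (q' : 'I_k)
    (x : Vgen n) (y : Vgen m) (z : Vgen l) :
  (p < q)%N -> p' = p :> nat -> (q'.+1 = q + m)%N ->
  insertion e2 q' (insertion e1 p (x, y), z)
  = insertion e2' p' (insertion e1' q (x, z), y).
Proof.
move=> pq p'E q'E; apply: coef_ext => i j ij; rewrite !coef_insertion /= p'E.
have qn := ltn_ord q.
have cc u : collapse_val p m (collapse_val q' l u) = collapse_val q l (collapse_val p m u).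
  by rewrite /collapse_val; repeat case: ifP; lia.
rewrite !cc -!addrA; congr (_ + _); rewrite addrC; congr (_ + _).
  have qc u : (q <= collapse_val p m u)%N = (q' <= u)%N.
    by rewrite /collapse_val; repeat case: ifP; lia.
  rewrite !qc; case: ifP => // /andP[qi qj].
  have cq u : (q' <= u)%N -> (collapse_val p m u - q)%N = (u - q')%N.
    by rewrite /collapse_val; repeat case: ifP; lia.
  by rewrite !cq.
have pc u : (p <= collapse_val q' l u)%N = (p <= u)%N.
  by rewrite /collapse_val; repeat case: ifP; lia.
rewrite !pc; case: ifP => // /andP[pi pj].
(* An index >= q' gives different arguments of coef on the two sides, both out
   of the range of y because q' >= p + m. *)
case: (boolP ((i < q') && (j < q'))%N) => [/andP[iq jq]|out].
  by rewrite /collapse_val iq jq.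
rewrite !coef_eq0 //; first by lia.
by rewrite /collapse_val; repeat case: ifP; lia.
Qed.

(** * Bilinearity of the wedge product *)

Fact wedge_is_linear (V : vectType rat) (x : V) : linear (wedge x).
Proof.
move=> a y z; apply/matrixP => i j; rewrite !mxE !linearP /=.
by rewrite mulrDl mulrDr mulrBr mulrCA -mulrA opprD addrACA.
Qed.
HB.instance Definition _ (V : vectType rat) (x : V) :=
  GRing.isLinear.Build rat V (tens_sq V) _ (wedge x) (wedge_is_linear x).

Lemma wedgeC (V : vectType rat) (x y : V) : wedge x y = - wedge y x.
Proof. by rewrite /wedge opprB. Qed.

Lemma wedge_sumr_mem (V : vectType rat) (U : {vspace tens_sq V})
    (I : finType) (P : pred I) (F : I -> V) (x : V) :
  (forall i, P i -> wedge x (F i) \in U) -> wedge x (\sum_(i | P i) F i) \in U.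
Proof. by move=> h; rewrite linear_sum; apply: memv_suml. Qed.

Lemma wedge_suml_mem (V : vectType rat) (U : {vspace tens_sq V})
    (I : finType) (P : pred I) (F : I -> V) (y : V) :
  (forall i, P i -> wedge (F i) y \in U) -> wedge (\sum_(i | P i) F i) y \in U.
Proof.
move=> h; rewrite wedgeC memvN; apply: wedge_sumr_mem => i Pi.
by rewrite wedgeC memvN h.
Qed.

Lemma wedge_Zr_mem (V : vectType rat) (U : {vspace tens_sq V}) a (x y : V) :
  wedge x y \in U -> wedge x (a *: y) \in U.
Proof. by move=> h; rewrite linearZ memvZ. Qed.

Lemma wedge_Zl_mem (V : vectType rat) (U : {vspace tens_sq V}) a (x y : V) :
  wedge x y \in U -> wedge (a *: x) y \in U.
Proof. by move=> h; rewrite wedgeC memvN wedge_Zr_mem // wedgeC memvN. Qed.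

Lemma inj1E (V W : vectType rat) (v : V) : inj1 V W v = (v, 0).
Proof. by rewrite lfunE. Qed.

Lemma inj2E (V W : vectType rat) (w : W) : inj2 V W w = (0, w).
Proof. by rewrite lfunE. Qed.

Lemma mixedP (V W : vectType rat) (v : V) (w : W) :
  wedge (inj1 V W v) (inj2 V W w) \in mixed V W.
Proof.
rewrite (coord_vbasis (memvf v)) (coord_vbasis (memvf w)).
rewrite (linear_sum (inj1 V W)) (linear_sum (inj2 V W)) /=.
apply: wedge_suml_mem => i _; apply: wedge_sumr_mem => j _.
rewrite [inj1 V W _]linearZ [inj2 V W _]linearZ /=.
apply/wedge_Zl_mem/wedge_Zr_mem/memv_span/allpairs_f; rewrite mem_nth // size_tuple //.
Qed.

(** * The structure maps on generators *)

Lemma tgenC n (i j : 'I_n) : tgen i j = tgen j i.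
Proof. by rewrite /tgen setUC. Qed.

Lemma lin_ext_tgen n (W : vectType rat) (f : {set 'I_n} -> W) (i j : 'I_n) :
  i != j -> lin_ext_fun (fun A : edge n => f (val A)) (tgen i j) = f [set i; j].
Proof.
move=> ij; have c2 : #|[set i; j]| == 2%N by rewrite cards2 ij.
rewrite /lin_ext_fun (bigD1 (Sub [set i; j] c2)) //= !ffunE eqxx scale1r.
rewrite big1 ?addr0 // => B; rewrite ffunE -(val_eqE B) SubK => /negbTE->.
by rewrite scale0r.
Qed.

Lemma relabel_tgen n (s : 'S_n) (i j : 'I_n) : i != j ->
  relabel s (tgen i j) = tgen (s i) (s j).
Proof.
move=> ij; rewrite lfunE /= (lin_ext_tgen (fun A => tset (s @: A))) //.
by rewrite imsetU1 imset_set1.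
Qed.

Lemma insertion_tgenr n m k (e : (n + m = k.+1)%N) (p : 'I_n) (a b : 'I_m) :
  a != b -> insertion e p (0, tgen a b) = tgen (embed e p a) (embed e p b).
Proof.
move=> ab; rewrite lfunE /= /insertion_fun /= linear0 add0r.
rewrite (lin_ext_tgen (fun A => tset (embed e p @: A))) //.
by rewrite imsetU1 imset_set1.
Qed.

Lemma insertion_tgenl n m k (e : (n + m = k.+1)%N) (p : 'I_n) (i j : 'I_n) :
  i != j ->
  insertion e p (tgen i j, 0)
  = \sum_(a | collapse e p a == i) \sum_(b | collapse e p b == j) tgen a b.
Proof.
move=> ij; apply: coef_ext => u v uv.
rewrite coef_insertionl linear_sum /=.
have ind (x y : 'I_k) :
    \sum_(a | collapse e p a == i) \sum_(b | collapse e p b == j)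
      ((a == x) && (b == y))%:R
    = ((collapse e p x == i) && (collapse e p y == j))%:R :> rat.
  rewrite big_mkcond (bigD1 x) //= eqxx [X in _ + X]big1 ?addr0; last first.
    by move=> a /negbTE ax; rewrite ax big1 // if_same.
  case: ifP => //= _; rewrite big_mkcond (bigD1 y) //= eqxx big1 ?addr0.
    by case: ifP.
  by move=> b /negbTE b_y; rewrite b_y if_same.
transitivity (((collapse e p u == i) && (collapse e p v == j))%:R
              + ((collapse e p v == i) && (collapse e p u == j))%:R : rat^o).
  case: (eqVneq (collapse e p u) (collapse e p v)) => [E|uv'].
    rewrite coef_eq0; last by have /= -> := congr1 val E; rewrite eqxx.
    rewrite -E (_ : _ && _ = false) ?addr0 //.
    by apply: contraNF ij => /andP[/eqP<- /eqP<-].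
  rewrite coef_tgen // -!(inj_eq val_inj) /=.
  by rewrite ![_ == collapse_val _ _ _]eq_sym.
rewrite -!ind -big_split; apply: eq_bigr => a /eqP ai.
rewrite linear_sum -big_split; apply: eq_bigr => b /eqP bj.
by rewrite /= coef_tgen //; apply: contraNneq ij => ab; rewrite -ai -bj ab.
Qed.

(** * Drinfeld-Kohno relations are stable *)

Lemma DK_disjoint n (i j k l : 'I_n) :
  uniq [:: i; j; k; l] -> wedge (tgen i j) (tgen k l) \in DK_rel n.
Proof.
move=> u; apply: (subvP (addvSl _ _)); rewrite memvE.
apply: (sumv_sup i) => //; apply: (sumv_sup j) => //; apply: (sumv_sup k) => //.
exact: (sumv_sup l).
Qed.

Lemma DK_triangle n (i j k : 'I_n) :
  uniq [:: i; j; k] -> wedge (tgen i j) (tgen i k + tgen j k) \in DK_rel n.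
Proof.
move=> u; apply: (subvP (addvSr _ _)); rewrite memvE.
apply: (sumv_sup i) => //; apply: (sumv_sup j) => //; exact: (sumv_sup k).
Qed.

Lemma DK_rel_sub n (U : {vspace tens_sq (Vgen n)}) :
  (forall i j k l : 'I_n, uniq [:: i; j; k; l] ->
     wedge (tgen i j) (tgen k l) \in U) ->
  (forall i j k : 'I_n, uniq [:: i; j; k] ->
     wedge (tgen i j) (tgen i k + tgen j k) \in U) ->
  (DK_rel n <= U)%VS.
Proof.
move=> hd ht; rewrite /DK_rel subv_add; apply/andP; split.
  by do 3!apply/subv_sumP => ? _; apply/subv_sumP => ? ?; rewrite -memvE hd.
by do 2!apply/subv_sumP => ? _; apply/subv_sumP => ? ?; rewrite -memvE ht.
Qed.

(** The terms x = a and x = b add up to the triangle relation of a, b, d; for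
    the other terms {a, b} and {x, d} are disjoint. *)
Lemma DK_star k (X : pred 'I_k) (a b d : 'I_k) :
  X a -> X b -> a != b -> ~~ X d ->
  wedge (tgen a b) (\sum_(x | X x) tgen x d) \in DK_rel k.
Proof.
move=> Xa Xb ab Xd.
have nd x : X x -> x != d by move=> Xx; apply: contraNneq Xd => <-.
rewrite (bigD1 a) //= (bigD1 b) /=; last by rewrite Xb eq_sym.
rewrite addrA linearD memvD //=.
  by apply: DK_triangle; rewrite /= !inE negb_or ab !nd.
apply: wedge_sumr_mem => x /andP[/andP[Xx xa] xb].
by apply: DK_disjoint; rewrite /= !inE !negb_or ab !nd //= ![_ == x]eq_sym xa xb.
Qed.

Lemma limg_DK_rel_sub n (W : vectType rat) (f : 'Hom(Vgen n, W))
    (U : {vspace tens_sq W}) :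
  (forall i j k l : 'I_n, uniq [:: i; j; k; l] ->
     wedge (f (tgen i j)) (f (tgen k l)) \in U) ->
  (forall i j k : 'I_n, uniq [:: i; j; k] ->
     wedge (f (tgen i j)) (f (tgen i k) + f (tgen j k)) \in U) ->
  (tens2 f @: DK_rel n <= U)%VS.
Proof.
move=> hd ht; apply/subvP => _ /memv_imgP[w wDK ->]; rewrite memv_preim.
apply: subvP w wDK; apply: DK_rel_sub => [i j k l|i j k] u;
  rewrite -memv_preim tens2_wedge; first exact: hd.
by rewrite linearD ht.
Qed.

Lemma DK_relabel n (s : 'S_n) : (tens2 (relabel s) @: DK_rel n <= DK_rel n)%VS.
Proof.
apply: limg_DK_rel_sub => [i j k l|i j k] u.
  have u' : uniq (map s [:: i; j; k; l]) by rewrite map_inj_uniq //; apply: perm_inj.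
  by rewrite !relabel_tgen ?DK_disjoint //; move: u; rewrite /= !inE !negb_or; lia.
have u' : uniq (map s [:: i; j; k]) by rewrite map_inj_uniq //; apply: perm_inj.
by rewrite /= !relabel_tgen ?DK_triangle //; move: u; rewrite /= !inE !negb_or; lia.
Qed.

Section DKInsertion.
Variables (n m k : nat) (e : (n + m = k.+1)%N) (p : 'I_n).

Lemma collapse_embed a : collapse e p (embed e p a) = p.
Proof.
apply: val_inj; rewrite /= /collapse_val.
by have := ltn_ord a; do 2?case: ifP; lia.
Qed.

(** Relations between disjoint edges are expanded into relations of the same
    kind, since labels in different fibres differ.  A triangle relation is
    expanded into stars whose set X is the union of the fibres over i and j. *)
Lemma insertion_DKl :
  (tens2 (insertion e p) @: (tens2 (inj1 (Vgen n) (Vgen m)) @: DK_rel n)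
   <= DK_rel k)%VS.
Proof.
apply/subvP => _ /memv_imgP[_ /memv_imgP[w wDK ->] ->]; rewrite !memv_preim.
apply: subvP w wDK; apply: DK_rel_sub => [i j l r|i j l] u;
  rewrite -!memv_preim !tens2_wedge ?(linearD (inj1 _ _))
    ?(linearD (insertion e p)) /= !inj1E;
  rewrite !insertion_tgenl; try by move: u; rewrite /= !inE !negb_or; lia.
  do 2![apply: wedge_suml_mem => ? /eqP ?]; do 2![apply: wedge_sumr_mem => ? /eqP ?].
  by apply/DK_disjoint/(map_uniq (f := collapse e p)); rewrite /=; subst.
move: u; rewrite /= !inE !negb_or => /andP[/andP[ij il] /andP[jl _]].
apply: wedge_suml_mem => a /eqP ai; apply: wedge_suml_mem => b /eqP bj.
rewrite exchange_big [X in _ + X]exchange_big -big_split.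
apply: wedge_sumr_mem => z /eqP zl /=.
rewrite (_ : _ + _ = \sum_(x | collapse e p x \in [:: i; j]) tgen x z).
  apply: DK_star; rewrite ?inE ?ai ?bj ?eqxx ?orbT //.
    by apply: contraNneq ij => ab; rewrite -ai -bj ab.
  by rewrite zl negb_or ![l == _]eq_sym il jl.
rewrite [RHS](bigID (fun x => collapse e p x == i)) /=; congr (_ + _).
  by apply: eq_bigl => x; rewrite !inE; case: (_ == i); rewrite ?andbF.
apply: eq_bigl => x; rewrite !inE; case: (eqVneq (collapse e p x) i) => [->|_].
  by rewrite andbF (negbTE ij).
by rewrite andbT.
Qed.

(** By bilinearity x = t_ij and y = t_ab, and the images of a and b lie in the
    fibre over p.  If i or j is p, DK_star applies to this fibre; otherwise the
    edges in the image of x avoid it. *)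
Lemma insertion_mixed (x : Vgen n) (y : Vgen m) :
  wedge (insertion e p (x, 0)) (insertion e p (0, y)) \in DK_rel k.
Proof.
have -> : insertion e p (x, 0) = \sum_A x A *: insertion e p (tset (val A), 0).
  have inj1v v : (v, 0) = inj1 (Vgen n) (Vgen m) v by rewrite inj1E.
  rewrite {1}[x]Vgen_decomp inj1v (linear_sum (inj1 _ _)) (linear_sum (insertion e p)).
  by apply: eq_bigr => A _; rewrite !linearZ inj1v.
have -> : insertion e p (0, y) = \sum_A y A *: insertion e p (0, tset (val A)).
  have inj2v v : (0, v) = inj2 (Vgen n) (Vgen m) v by rewrite inj2E.
  rewrite {1}[y]Vgen_decomp inj2v (linear_sum (inj2 _ _)) (linear_sum (insertion e p)).
  by apply: eq_bigr => A _; rewrite !linearZ inj2v.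
apply: wedge_suml_mem => A _; apply: wedge_sumr_mem => B _.
apply/wedge_Zl_mem/wedge_Zr_mem.
have [i [j [ij ->]]] := edgeP A; have [a [b [ab ->]]] := edgeP B.
rewrite -!/(tgen _ _) insertion_tgenl // insertion_tgenr //.
rewrite wedgeC memvN.
have ab' : embed e p a != embed e p b by rewrite (inj_eq (@embed_inj _ _ _ e p)).
have key (i' j' : 'I_n) : i' != j' -> j' != p ->
    wedge (tgen (embed e p a) (embed e p b))
     (\sum_(u | collapse e p u == i') \sum_(v | collapse e p v == j') tgen u v)
     \in DK_rel k.
  move=> ij' jp; case: (eqVneq i' p) => [->|ip].
    rewrite exchange_big; apply: wedge_sumr_mem => v /eqP vj.
    by apply: DK_star => //; rewrite ?collapse_embed // vj.
  apply: wedge_sumr_mem => u /eqP ui; apply: wedge_sumr_mem => v /eqP vj.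
  have out c w : collapse e p w != p -> embed e p c != w.
    by apply: contraNneq => <-; rewrite collapse_embed.
  apply: DK_disjoint; rewrite /= !inE !negb_or ab' !out ?ui ?vj //=.
  by rewrite andbT; apply: contraNneq ij' => uv; rewrite -ui -vj uv.
case: (eqVneq j p) => [jp|]; last exact: key.
rewrite exchange_big /=.
under eq_bigr do under eq_bigr do rewrite tgenC.
by apply: key; rewrite -?jp // eq_sym.
Qed.

End DKInsertion.

Lemma insertion_DKr n m k (e : (n + m = k.+1)%N) (p : 'I_n) :
  (tens2 (insertion e p) @: (tens2 (inj2 (Vgen n) (Vgen m)) @: DK_rel m)
   <= DK_rel k)%VS.
Proof.
apply/subvP => _ /memv_imgP[_ /memv_imgP[w wDK ->] ->]; rewrite !memv_preim.
apply: subvP w wDK; apply: DK_rel_sub => [i j l r|i j l] u;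
  rewrite -!memv_preim !tens2_wedge ?(linearD (inj2 _ _))
    ?(linearD (insertion e p)) /= !inj2E;
  rewrite !insertion_tgenr; try by move: u; rewrite /= !inE !negb_or; lia.
  have u' : uniq (map (embed e p) [:: i; j; l; r]).
    by rewrite map_inj_uniq //; apply: embed_inj.
  exact: DK_disjoint.
have u' : uniq (map (embed e p) [:: i; j; l]).
  by rewrite map_inj_uniq //; apply: embed_inj.
exact: DK_triangle.
Qed.

Lemma insertion_DK n m k (e : (n + m = k.+1)%N) (p : 'I_n) :
  @is_qd_mor (qd_sum (obj DK n) (obj DK m)) (obj DK k) (insertion e p).
Proof.
rewrite /is_qd_mor /= /qd_sum_rel limgD limgD 2!subv_add -andbA; apply/and3P; split.
- exact: insertion_DKl.
- rewrite limg_span; apply/span_subvP => _ /mapP[_ /allpairsP[u [_ _ ->]] ->].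
  by rewrite tens2_wedge inj1E inj2E; apply: insertion_mixed.
- exact: insertion_DKr.
Qed.

Lemma DK_suboperad : is_suboperad BKW (fun n => relations (obj DK n)).
Proof.
split=> [n|]; first exact: DK_rel_wedge2.
exists DK_rel_wedge2; split=> /=.
- exact: DK_relabel.
- exact: insertion_DK.
- exact: relabel1.
- exact: relabelM.
- by move=> *; apply: insertion_equivariant.
- exact: insertion_unitl.
- exact: insertion_unitr.
- by move=> *; apply: insertion_sequential.
- by move=> *; apply: insertion_parallel.
Qed.

(** * Drinfeld-Kohno relations are forced *)

(** Extend s to an enumeration of 'I_n by appending the missing elements. *)
Lemma perm_extends n (s : seq 'I_n) : uniq s ->
  exists r : 'S_n, forall (d i : 'I_n), (i < size s)%N -> r i = nth d s i.
Proof.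
move=> us; pose t := s ++ [seq x <- enum 'I_n | x \notin s].
have ut : uniq t.
  rewrite cat_uniq us filter_uniq ?enum_uniq // andbT.
  by apply/hasPn => x; rewrite mem_filter => /andP[].
have st : size t = n.
  rewrite -[RHS]card_ord -(card_uniqP ut); apply: eq_card => x.
  by rewrite mem_cat mem_filter mem_enum !inE andbT orbN.
have t_inj : injective (fun i : 'I_n => nth i t i).
  move=> i j; rewrite (set_nth_default i) ?st // => /eqP.
  by rewrite nth_uniq ?st // => /eqP/val_inj.
exists (perm t_inj) => d i lt_is.
by rewrite permE nth_cat lt_is; apply: set_nth_default.
Qed.

Section Minimality.
Variable S : forall n, {vspace tens_sq (Vgen n)}.
Hypothesis subS : is_suboperad BKW S.

Lemma suboperad_relabel n (s : 'S_n) (x y : Vgen n) :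
  wedge x y \in S n -> wedge (relabel s x) (relabel s y) \in S n.
Proof.
move=> xyS; have [_ [hS opS]] := subS.
rewrite -tens2_wedge; apply: (subvP (act_mor opS s)); exact: memv_img.
Qed.

Lemma suboperad_mixed n m k (e : (n + m = k.+1)%N) (p : 'I_n)
    (x : Vgen n) (y : Vgen m) :
  wedge (insertion e p (x, 0)) (insertion e p (0, y)) \in S k.
Proof.
have [_ [hS opS]] := subS.
rewrite -inj1E -inj2E -tens2_wedge; apply: (subvP (comp_mor opS e p)).
apply: memv_img; apply: (subvP (addvSl _ _)); apply: (subvP (addvSr _ _)).
exact: mixedP.
Qed.

(** Up to a permutation, this is the mixed relation of t_01 in arity n - 1 and
    t_01 in arity 2, composed at input 0. *)
Lemma suboperad_triangle n (i j k : 'I_n) :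
  uniq [:: i; j; k] -> wedge (tgen i j) (tgen i k + tgen j k) \in S n.
Proof.
move=> u; have n3 : (2 < n)%N.
  by rewrite -[n]card_ord cardE; apply: (uniq_leq_size u) => x _; rewrite mem_enum.
case: n i j k u n3 => [|[|[|n]]] // i j k u _.
have e : (n.+2 + 2 = n.+3.+1)%N by rewrite addn2.
pose o d (h : (d < n.+3)%N) : 'I_n.+3 := Ordinal h.
have base : wedge (tgen (@o 0 isT) (@o 1 isT))
    (tgen (@o 0 isT) (@o 2 isT) + tgen (@o 1 isT) (@o 2 isT)) \in S n.+3.
  rewrite wedgeC memvN.
  have := suboperad_mixed e ord0 (tgen ord0 (Ordinal (isT : (1 < n.+2)%N)))
            (tgen ord0 (Ordinal (isT : (1 < 2)%N))).
  rewrite insertion_tgenl // insertion_tgenr //.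
  (* Over 0 the collapse map has the fibre {0, 1}, over 1 the fibre {2}. *)
  rewrite (eq_bigr (fun a => tgen a (@o 2 isT))); last first.
    by move=> a _; apply: big_pred1 => -[[|[|[|?]]] ?]; rewrite -!(inj_eq val_inj).
  rewrite (bigD1 (@o 0 isT)) //= (big_pred1 (@o 1 isT)); last first.
    by case=> [[|[|[|?]]] ?]; rewrite -!(inj_eq val_inj).
  have -> : embed e ord0 ord0 = @o 0 isT by apply: val_inj.
  by have -> : embed e ord0 (Ordinal (isT : (1 < 2)%N)) = @o 1 isT by apply: val_inj.
have [r rE] := perm_extends u.
have r0 : r (@o 0 isT) = i by apply: (rE i).
have r1 : r (@o 1 isT) = j by apply: (rE i).
have r2 : r (@o 2 isT) = k by apply: (rE i).
have := suboperad_relabel r base.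
by rewrite (linearD (relabel r)) /= !relabel_tgen ?r0 ?r1 ?r2.
Qed.

(** Up to a permutation, this is the mixed relation of t_12 in arity n - 1 and
    t_01 in arity 2, composed at input 0. *)
Lemma suboperad_disjoint n (i j k l : 'I_n) :
  uniq [:: i; j; k; l] -> wedge (tgen i j) (tgen k l) \in S n.
Proof.
move=> u; have n4 : (3 < n)%N.
  by rewrite -[n]card_ord cardE; apply: (uniq_leq_size u) => x _; rewrite mem_enum.
case: n i j k l u n4 => [|[|[|[|n]]]] // i j k l u _.
have e : (n.+3 + 2 = n.+4.+1)%N by rewrite addn2.
pose o d (h : (d < n.+4)%N) : 'I_n.+4 := Ordinal h.
have base : wedge (tgen (@o 0 isT) (@o 1 isT)) (tgen (@o 2 isT) (@o 3 isT)) \in S n.+4.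
  rewrite wedgeC memvN.
  have := suboperad_mixed e ord0
    (tgen (Ordinal (isT : (1 < n.+3)%N)) (Ordinal (isT : (2 < n.+3)%N)))
    (tgen ord0 (Ordinal (isT : (1 < 2)%N))).
  rewrite insertion_tgenl // insertion_tgenr //.
  rewrite (eq_bigr (fun a => tgen a (@o 3 isT))); last first.
    by move=> a _; apply: big_pred1 => -[[|[|[|[|?]]]] ?]; rewrite -!(inj_eq val_inj).
  rewrite (big_pred1 (@o 2 isT)); last first.
    by case=> [[|[|[|[|?]]]] ?]; rewrite -!(inj_eq val_inj).
  have -> : embed e ord0 ord0 = @o 0 isT by apply: val_inj.
  by have -> : embed e ord0 (Ordinal (isT : (1 < 2)%N)) = @o 1 isT by apply: val_inj.
have [r rE] := perm_extends u.
have r0 : r (@o 0 isT) = i by apply: (rE i).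
have r1 : r (@o 1 isT) = j by apply: (rE i).
have r2 : r (@o 2 isT) = k by apply: (rE i).
have r3 : r (@o 3 isT) = l by apply: (rE i).
have := suboperad_relabel r base.
by rewrite !relabel_tgen ?r0 ?r1 ?r2 ?r3.
Qed.
End Minimality.

Theorem theorem5p2 :
  is_suboperad BKW (fun n => relations (obj DK n)) /\
  forall S : forall n : nat, {vspace tens_sq (generators (obj BKW n))},
    is_suboperad BKW S ->
    forall n : nat, (relations (obj DK n) <= S n)%VS.
Proof.
split; first exact: DK_suboperad.
move=> S subS n; apply: DK_rel_sub => [i j k l|i j k].
  exact: suboperad_disjoint.
exact: suboperad_triangle.
Qed.
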